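(* Let $T$ be a tree and let $1 \leq p < \infty$. The forward shift $S$ is bounded on $\mathbb{H}^p(T)$ if and only if the set $$\left\{ \frac{K(1,n-1)\, \gamma(n-1)}{\gamma(n)} \, : \, n \in \mathbb{N} \right\}$$ is bounded. In this case, $$\| S \| = \left( \sup \left\{ \frac{K(1,n-1)\, \gamma(n-1)}{\gamma(n)} \, : \, n \in \mathbb{N} \right\} \right)^{1/p}.$$
   Context: $\mathbb{N}=\{1,2,\dots\}$, $\mathbb{N}_0=\{0,1,2,\dots\}$. A tree $T$ means a connected graph with no cycles, with countably infinitely many vertices, locally finite (every vertex has finitely many adjacent vertices), with a distinguished vertex $\mathrm{o}$ called the root. For a vertex $v$, $|v|$ is the number of edges in the unique path between $\mathrm{o}$ and $v$; $v$ is in level $n$ if $|v|=n$, and $\gamma(n)$ is the number of vertices in level $n$. For $v\neq \mathrm{o}$, $\operatorname{par}(v)$ (the parent of $v$) is the unique vertex $w$ on the path from $v$ to $\mathrm{o}$ with $|w|=|v|-1$; the children of $v$ are the vertices $u$ with $\operatorname{par}(u)=v$ (vertices may have no children). $\gamma(1,v)$ is the number of children of $v$, and for $r\in\mathbb{N}_0$, $K(1,r):=\max\{\gamma(1,v): |v|=r\}$. $\mathcal{F}$ is the vector space of all complex-valued functions on the set of vertices of $T$. For $f\in\mathcal{F}$ and $n\in\mathbb{N}_0$, $M_p(n,f):=\left(\frac{1}{\gamma(n)}\sum_{|v|=n}|f(v)|^p\right)^{1/p}$. The Hardy space $\mathbb{H}^p(T)$ is the set of $f\in\mathcal{F}$ with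 $\|f\|:=\sup_{n\in\mathbb{N}_0}M_p(n,f)<\infty$; it is a Banach space with this norm. The forward shift $S:\mathcal{F}\to\mathcal{F}$ is the linear map $(Sf)(v)=f(\operatorname{par}(v))$ if $v\neq \mathrm{o}$ and $(Sf)(\mathrm{o})=0$. ''$S$ is bounded on $\mathbb{H}^p(T)$'' means that $S$ maps $\mathbb{H}^p(T)$ into itself and is a bounded linear operator there; $\|S\|$ is then its operator norm. *)

(* Defs.v *)
From HB Require Import structures.
From mathcomp Require Import all_boot all_order all_algebra.
From mathcomp Require Import finmap.
From mathcomp Require Import all_classical all_reals all_analysis.
From mathcomp Require Import complex.

Set Implicit Arguments.
Unset Strict Implicit.
Unset Printing Implicit Defensive.

Import Order.TTheory GRing.Theory Num.Theory.
Import numFieldNormedType.Exports.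

Local Open Scope classical_set_scope.
Local Open Scope ring_scope.

Record tree := Tree {
  vertex :> choiceType;
  adj : rel vertex;
  root : vertex;
  adj_sym : symmetric adj;
  adj_irr : irreflexive adj;
  adj_connected : forall u v : vertex, exists2 s, path adj u s & last u s = v;
  adj_acyclic : forall c : seq vertex, (2 < size c)%N -> ~ ucycle adj c;
  adj_locally_finite : forall v : vertex, finite_set [set w | adj v w];
  vertex_countably_infinite : ([set: vertex] #= [set: nat])%card
}.

Arguments root : clear implicits.

Section TreeDefs.
Variable T : tree.
Implicit Types (u v w : T) (n r : nat).

(* As in path.v, the simple path o, x1, ..., xk = v is represented by
   [:: x1; ...; xk], so its number of edges is the size of that sequence.
   In a tree such a path exists and is unique, so the default value of xget
   is not used. *)
Definition root_path v : seq T :=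
  xget [::] [set s | [/\ path (@adj T) (root T) s, last (root T) s = v
                       & uniq (root T :: s)]].

Definition depth v : nat := size (root_path v).

Definition level n : set T := [set v | depth v = n].

(* Only meaningful for v <> root T. *)
Definition par v : T :=
  xget (root T) [set w | w \in root T :: root_path v /\ depth w = (depth v).-1].

Definition children v : set T := [set u | u <> root T /\ par u = v].

(* Levels and sets of children are finite by local finiteness, so fset_set
   returns their actual elements here. *)
Definition gamma n : nat := #|` fset_set (level n)|.

Definition gamma1 v : nat := #|` fset_set (children v)|.

(* The levels of an infinite locally finite tree are nonempty, so this is
   the maximum over a nonempty finite set. *)
Definition K1 r : nat := \max_(v <- fset_set (level r)) gamma1 v.

End TreeDefs.

Section Hardy.
Variables (R : realType) (T : tree).

(* R[i]^o is R[i] seen as a vector space over itself. *)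
Definition cfunctions := T -> R[i]^o.
HB.instance Definition _ := GRing.Lmodule.on cfunctions.

Implicit Types (p : R) (f : cfunctions).

(* The norm of R[i] takes values in R[i]; Re retrieves the real modulus. *)
Definition Mp p (n : nat) f : R :=
  ((gamma T n)%:R^-1 * \sum_(v \in level n) (complex.Re `|f v : R[i]|) `^ p) `^ p^-1.

Definition hardy_norm p f : \bar R :=
  ereal_sup [set (Mp p n f)%:E | n in [set: nat]].

Definition hardy p : set cfunctions := [set f | (hardy_norm p f < +oo)%E].

Definition forward_shift f : cfunctions :=
  fun v => if v == root T then 0 else f (par v).

Fact forward_shift_is_linear : linear forward_shift.
Proof.
move=> a f g; apply/funext => v; rewrite /forward_shift !fctE.
by case: ifP => // _; rewrite scaler0 addr0.
Qed.

HB.instance Definition _ :=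
  GRing.isLinear.Build R[i] cfunctions cfunctions _ forward_shift
    forward_shift_is_linear.

Definition bounded_on_hardy p (A : {linear cfunctions -> cfunctions}) : Prop :=
  (forall f, hardy p f -> hardy p (A f)) /\
  (exists C : R, forall f, hardy p f ->
     (hardy_norm p (A f) <= C%:E * hardy_norm p f)%E).

Definition hardy_opnorm p (A : {linear cfunctions -> cfunctions}) : \bar R :=
  ereal_sup [set hardy_norm p (A f) | f in
    [set f | hardy p f /\ (hardy_norm p f <= 1)%E]].

Definition shift_ratios : set R :=
  [set (K1 T n.-1)%:R * (gamma T n.-1)%:R / (gamma T n)%:R
    | n in [set n | (0 < n)%N]].

End Hardy.

Arguments forward_shift R T : clear implicits.
Arguments shift_ratios R T : clear implicits.

(* Main.v *)
Require Import Defs.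
From mathcomp Require Import all_boot all_order all_algebra.
From mathcomp Require Import finmap.
From mathcomp Require Import all_classical all_reals all_analysis.
From mathcomp Require Import complex.

Import Order.TTheory GRing.Theory Num.Theory.
Import numFieldNormedType.Exports.
Local Open Scope classical_set_scope.
Local Open Scope ring_scope.

Set Implicit Arguments.
Unset Strict Implicit.
Unset Printing Implicit Defensive.

(** Write [gamma n] for the number of vertices of level [n], [gamma1 w] for the
number of children of [w], and [K1 n] for the largest [gamma1 w] on level [n].
The children of the vertices of level [n] partition level [n.+1], so for every
[f] (lemma [level_sum_shift])

  sum over level n.+1 of |S f|^p = sum over w in level n of gamma1 w * |f w|^p.

Bounding [gamma1 w] by [K1 n] and normalising by [gamma n.+1] gives
[Mp p n.+1 (S f) <= r_n ^ (1/p) * Mp p n f], where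
[r_n = K1 n * gamma n / gamma n.+1] (lemma [Mp_shift_le]); since [S f] vanishes
at the root, the norm of [S] is at most [(sup r_n) ^ (1/p)].

Conversely, let [w] be a vertex of level [n] with [K1 n] children. The function
equal to [(gamma n) ^ (1/p)] at [w] and to 0 elsewhere has norm 1, and its shift
has [p]-mean exactly [r_n ^ (1/p)] on level [n.+1] (lemma
[shift_ratio_attained]). Hence every bound on [S] on the unit ball bounds all
the [r_n], and the norm of [S] is at least [(sup r_n) ^ (1/p)].

The partition into children relies on the uniqueness of simple paths in an
acyclic graph (lemma [simple_path_unique]): it makes an initial segment of the
path from the root to [v] the path from the root to its own end, so the parent
of [v] lies exactly one level above [v]. It also gives the finiteness of the
levels, by induction from local finiteness. No level is required to be nonempty:
on an empty level sums, cardinals and [K1] vanish, and division by zero gives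
zero. *)

(** * Simple paths in a tree *)

Lemma split_first_common (V : eqType) (s t : seq V) : has (mem t) s ->
  exists y s1 s2 t1 t2,
    [/\ s = s1 ++ y :: s2, t = t1 ++ y :: t2 & ~~ has (mem t) s1].
Proof.
move=> /split_find[y s1 s2 yt s1t].
move: (yt) s1t => /= /splitPr[t1 t2] s1t.
by exists y, s1, s2, t1, t2; rewrite cat_rcons.
Qed.

(** Two simple paths from [x] that meet again begin with the same edge: otherwise
following one up to the first common vertex [y] and returning along the other
would give a cycle. *)
Lemma simple_paths_same_start (T : tree) (x : T) (s t : seq T) :
  path (@adj T) x s -> uniq (x :: s) ->
  path (@adj T) x t -> uniq (x :: t) ->
  has (mem t) s -> ohead s = ohead t.
Proof.
move=> ps us pt ut /split_first_common[y [s1 [s2 [t1 [t2 [sE tE s1t]]]]]].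
subst s t.
(* If both segments before the meeting point are empty, it is the first vertex
   of both paths. *)
have [s10|s1n0] := eqVneq (size s1 + size t1)%N 0%N.
  by case: s1 t1 s10 {ps us pt ut s1t} => [|? ?] [].
pose c := x :: rcons s1 y ++ rev t1.
exfalso; apply: (@adj_acyclic T c).
  by rewrite /= size_cat size_rcons size_rev addSn !ltnS lt0n.
move: us ut; rewrite /= !mem_cat !inE !negb_or !cat_uniq /= !negb_or.
move=> /and3P[/and3P[xs1 xy _] us1 /and3P[/andP[ys1 _] _ _]].
move=> /and3P[/and3P[xt1 _ _] ut1 /and3P[/andP[yt1 _] _ _]].
apply/andP; split.
- rewrite /c /= rcons_cat cat_path last_rcons.
  move: ps pt; rewrite -!cat_rcons !cat_path => /andP[-> _] /andP[pt _] /=.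
  rewrite -rev_cons.
  have := rev_path (@adj T) x (rcons t1 y).
  rewrite last_rcons belast_rcons => ->.
  by rewrite (eq_path (e' := @adj T))// => a b; rewrite adj_sym.
- rewrite /c /= mem_cat mem_rcons !inE mem_rev !negb_or xy xs1 xt1 /=.
  rewrite cat_uniq rcons_uniq rev_uniq ys1 us1 ut1 /= andbT.
  apply/hasPn => z; rewrite mem_rev mem_rcons inE negb_or => zt1.
  rewrite (memPn yt1)//=; apply: contra s1t => zs1.
  by apply/hasP; exists z => //=; rewrite mem_cat zt1.
Qed.

Lemma simple_path_unique (T : tree) (x : T) (s t : seq T) :
  path (@adj T) x s -> uniq (x :: s) ->
  path (@adj T) x t -> uniq (x :: t) -> last x s = last x t -> s = t.
Proof.
elim: s x t => [|a s IHs] x [|b t] //.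
- by move=> _ _ _ /andP[xt _] /= xE; rewrite xE mem_last in xt.
- by move=> _ /andP[xs _] _ _ /= xE; rewrite -xE mem_last in xs.
move=> ps us pt ut lst.
have [] : ohead (a :: s) = ohead (b :: t).
  apply: (@simple_paths_same_start _ x) => //.
  apply/hasP; exists (last a s); first exact: mem_last.
  by rewrite -[last a s]/(last x (a :: s)) lst /=; exact: (mem_last b t).
move=> ab; subst b; congr cons; move: ps us pt ut => /= /andP[_ ps] /andP[_ us].
by move=> /andP[_ pt] /andP[_ ut]; apply: IHs lst.
Qed.

(** * Depth, parents and levels *)

Lemma root_pathP (T : tree) (v : T) :
  [/\ path (@adj T) (Defs.root T) (root_path v),
      last (Defs.root T) (root_path v) = v & uniq (Defs.root T :: root_path v)].
Proof.
rewrite /root_path; apply: (@xgetPex _ [::]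
  [set s | [/\ path (@adj T) (Defs.root T) s, last (Defs.root T) s = v
                       & uniq (Defs.root T :: s)]]).
have [s ps] := adj_connected (Defs.root T) v.
by case: (shortenP ps) => s' ps' us' _ lv; exists s'.
Qed.

Lemma root_path_eq (T : tree) (v : T) (s : seq T) :
  path (@adj T) (Defs.root T) s -> uniq (Defs.root T :: s) ->
  last (Defs.root T) s = v -> root_path v = s.
Proof.
move=> ps us lv; have [pv lv' uv] := root_pathP v.
by apply: simple_path_unique (Defs.root T) _ _ pv uv ps us _; rewrite lv.
Qed.

(** An initial segment of the simple path from the root to [v] is itself the
simple path from the root to the vertex where it ends. *)
Lemma root_path_cat (T : tree) (v : T) (s t : seq T) :
  root_path v = s ++ t -> root_path (last (Defs.root T) s) = s.
Proof.
move=> vE; have [] := root_pathP v; rewrite vE cat_path -cat_cons cat_uniq.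
by move=> /andP[ps _] _ /andP[us _]; exact: root_path_eq.
Qed.

Lemma depth0_root (T : tree) (v : T) : depth v = 0%N -> v = Defs.root T.
Proof. by move=> /size0nil v0; have [_ <- _] := root_pathP v; rewrite v0. Qed.

Lemma depth_root (T : tree) : depth (Defs.root T) = 0%N.
Proof. by rewrite /depth (@root_path_eq _ _ [::]). Qed.

(** The vertex preceding [v] on its root path witnesses the choice that defines
[par v]. *)
Lemma depth_par (T : tree) (v : T) :
  v <> Defs.root T -> depth (par v) = (depth v).-1.
Proof.
move=> v0; rewrite /par.
suff /(xgetPex (Defs.root T)) [] :
  exists w, w \in Defs.root T :: root_path v /\ depth w = (depth v).-1 by [].
case/lastP vE : (root_path v) => [|s z].
  by case: v0; apply: depth0_root; rewrite /depth vE.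
exists (last (Defs.root T) s); split.
  by rewrite -rcons_cons mem_rcons inE mem_last orbT.
rewrite -cats1 in vE.
by rewrite /depth (root_path_cat vE) vE size_cat addn1.
Qed.

Lemma finite_level (T : tree) (n : nat) : finite_set (@level T n).
Proof.
elim: n => [|n IHn].
  apply: (@sub_finite_set _ _ [set Defs.root T]); last exact: finite_set1.
  by move=> v /depth0_root ->.
apply: (@sub_finite_set _ _ (\bigcup_(w in @level T n) [set v | adj w v])).
  move=> v; rewrite /level/= {1}/depth.
  case/lastP vE : (root_path v) => [//|s z]; rewrite size_rcons => -[sn].
  have [] := root_pathP v; rewrite vE rcons_path last_rcons => /andP[_ az] zv _.
  exists (last (Defs.root T) s) => /=; last by rewrite -zv.
  by rewrite /depth (@root_path_cat _ v s [:: z])// vE cats1.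
by apply: bigcup_finite => // w _; exact: adj_locally_finite.
Qed.

Lemma levelS_par (T : tree) (n : nat) (v : T) :
  @level T n.+1 v -> v <> Defs.root T /\ @level T n (par v).
Proof.
rewrite /level/= => vn; have v0 : v <> Defs.root T.
  by move=> v0; rewrite v0 depth_root in vn.
by rewrite depth_par// vn.
Qed.

Lemma children_level (T : tree) (n : nat) (w : T) :
  @level T n w -> children w `<=` @level T n.+1.
Proof.
rewrite /level/= => wn v [v0 pv].
have vn := depth_par v0; rewrite pv wn in vn.
by rewrite vn prednK// lt0n; apply/eqP => /depth0_root.
Qed.

(** Summation over level [n.+1] grouped by parents: each [w] of level [n] occurs
once for each of its children. *)
Lemma sum_levelS_par (R : pzRingType) (T : tree) (n : nat) (F : T -> R) :
  \sum_(v \in @level T n.+1) F (par v) =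
  \sum_(w \in @level T n) (gamma1 w)%:R * F w.
Proof.
do 2 (rewrite fsbig_finite; last exact: finite_level).
transitivity (\sum_(v <- fset_set (@level T n.+1))
  \sum_(w <- fset_set (@level T n)) (if par v == w then F w else 0)).
  rewrite big_seq [RHS]big_seq; apply: eq_bigr => v.
  rewrite (in_fset_set (finite_level _ _)) inE => /levelS_par[_ pn].
  rewrite (bigD1_seq (par v)) ?fset_uniq//=; last first.
    by rewrite (in_fset_set (finite_level _ _)) inE.
  rewrite eqxx big1 ?addr0// => w.
  by rewrite eq_sym => /negbTE ->.
(* For fixed [w], the inner sum counts the vertices of level [n.+1] whose parent
   is [w]. *)
rewrite exchange_big/= big_seq [RHS]big_seq; apply: eq_bigr => w.
rewrite (in_fset_set (finite_level _ _)) inE => wn.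
rewrite -big_mkcond/= big_const_seq iter_addr_0 -[LHS]mulr_natl; congr (_%:R * _).
rewrite /gamma1 -sum1_count card_fset_sum1 big_fset_condE/=.
congr (\sum_(_ <- enum_fset _) _)%N; apply/fsetP => v.
have fc : finite_set (children w).
  by apply: sub_finite_set (children_level wn) _; exact: finite_level.
rewrite !inE !in_fset_set//; last exact: finite_level.
apply/andP/idP; rewrite !inE.
  by move=> [/levelS_par[v0 _] /eqP].
by move=> cv; split; [exact: children_level cv|case: cv => _ ->].
Qed.

Lemma gamma1_le_K1 (T : tree) (n : nat) (w : T) :
  @level T n w -> (gamma1 w <= K1 T n)%N.
Proof.
move=> wn; rewrite /K1; apply: (leq_bigmax_seq (F := @gamma1 T)) => //.
by rewrite in_fset_set ?inE//; exact: finite_level.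
Qed.

(** The maximum over an empty level is 0, so a positive value is attained. *)
Lemma K1_attained (T : tree) (n : nat) :
  K1 T n <> 0%N -> exists2 w, @level T n w & gamma1 w = K1 T n.
Proof.
move=> K0; have [//|//] : K1 T n = 0%N \/
  exists2 w, @level T n w & gamma1 w = K1 T n.
rewrite /K1 big_seq.
elim/big_ind: _ => [|x y|w]; first by left.
  by move=> hx hy; case: (leqP x y).
by rewrite in_fset_set ?inE; [move=> wn; right; exists w|exact: finite_level].
Qed.

(** * Moduli, powers and ratios *)

Lemma Re_norm0 (R : rcfType) : complex.Re `|0 : R[i]| = 0.
Proof. by rewrite normr0. Qed.

Lemma Re_norm_real (R : rcfType) (x : R) : complex.Re `|x%:C%C| = `|x|.
Proof. by rewrite normc_def /= expr0n /= addr0 sqrtr_sqr. Qed.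

Lemma powR_invK (R : realType) (p x : R) : p != 0 -> 0 <= x ->
  (x `^ p^-1) `^ p = x.
Proof. by move=> p0 x0; rewrite -powRrM mulVf// powRr1. Qed.

Lemma powRK_inv (R : realType) (p x : R) : p != 0 -> 0 <= x ->
  (x `^ p) `^ p^-1 = x.
Proof. by move=> p0 x0; rewrite -powRrM mulfV// powRr1. Qed.

(** The ratio [K1 n * gamma n / gamma n.+1] between levels [n] and [n.+1], that
is, the ratio of index [n.+1] in [shift_ratios]; the shift of the index avoids
the predecessor. *)
Definition shift_ratio (R : realType) (T : tree) (n : nat) : R :=
  (K1 T n)%:R * (gamma T n)%:R / (gamma T n.+1)%:R.

Lemma shift_ratio_ge0 (R : realType) (T : tree) (n : nat) :
  0 <= shift_ratio R T n.
Proof. by rewrite /shift_ratio divr_ge0// mulr_ge0. Qed.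

Lemma shift_ratiosE (R : realType) (T : tree) :
  shift_ratios R T = range (shift_ratio R T).
Proof.
apply/seteqP; split => [_ [[//|n] _ <-]|_ [n _ <-]]; first by exists n.
by exists n.+1.
Qed.

Lemma bounded_shift_ratios (R : realType) (T : tree) :
  bounded_set (shift_ratios R T) <-> has_ubound (shift_ratios R T).
Proof.
rewrite shift_ratiosE.
have pf : ProperFilter (globally (range (shift_ratio R T))).
  by apply: (@globally_properfilter _ _ (shift_ratio R T 0)); exists 0%N.
split.
  move=> /ex_bound[M hM]; exists M => _ [n _ <-].
  by apply: le_trans (hM _ _); [exact: ler_norm|exists n].
move=> [M hM]; apply/ex_bound; exists M => _ [n _ <-] /=.
by rewrite ger0_norm ?shift_ratio_ge0//; apply: hM; exists n.
Qed.

(** * The forward shift on level means *)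

Section shift_means.
Variables (R : realType) (T : tree) (p : R).
Hypothesis p_gt0 : 0 < p.
Implicit Types (f : cfunctions R T) (n : nat).

Let p_neq0 : p != 0. Proof. exact: lt0r_neq0. Qed.

Lemma Mp_ge0 n f : 0 <= Mp p n f.
Proof. exact: powR_ge0. Qed.

Lemma level_sum_ge0 n f :
  0 <= \sum_(v \in @level T n) (complex.Re `|f v : R[i]|) `^ p.
Proof. by apply: fsumr_ge0 => v _; exact: powR_ge0. Qed.

Lemma hardy_norm_ge0 f : (0 <= hardy_norm p f)%E.
Proof.
apply: (@le_trans _ _ (Mp p 0 f)%:E); first by rewrite lee_fin Mp_ge0.
by apply: ereal_sup_ubound; exists 0%N.
Qed.

Lemma Mp_shift0 f : Mp p 0 (forward_shift R T f) = 0.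
Proof.
rewrite /Mp fsbig1 ?mulr0 ?powR0 ?invr_eq0// => v /depth0_root ->.
by rewrite /forward_shift eqxx Re_norm0 powR0.
Qed.

Lemma level_sum_shift n f :
  \sum_(v \in @level T n.+1)
     (complex.Re `|forward_shift R T f v : R[i]|) `^ p =
  \sum_(w \in @level T n) (gamma1 w)%:R * (complex.Re `|f w : R[i]|) `^ p.
Proof.
rewrite -(sum_levelS_par n (fun w => complex.Re `|f w : R[i]| `^ p)).
apply: eq_fsbigr => v; rewrite inE => /levelS_par[/eqP v0 _].
by rewrite /forward_shift (negbTE v0).
Qed.

Lemma Mp_shift_le n f :
  Mp p n.+1 (forward_shift R T f) <= shift_ratio R T n `^ p^-1 * Mp p n f.
Proof.
rewrite /Mp level_sum_shift.
set t := \sum_(v \in @level T n) _; set s := \sum_(v \in @level T n) _.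
have s0 : 0 <= s by apply: fsumr_ge0 => w _; rewrite mulr_ge0// powR_ge0.
have t0 : 0 <= t by exact: level_sum_ge0.
have st : s <= (K1 T n)%:R * t.
  rewrite /s /t !fsbig_finite; try exact: finite_level.
  rewrite mulr_sumr big_seq [leRHS]big_seq; apply: ler_sum => w.
  rewrite in_fset_set ?inE; last exact: finite_level.
  by move=> wn; rewrite ler_wpM2r ?powR_ge0// ler_nat gamma1_le_K1.
rewrite -powRM ?shift_ratio_ge0//; last by rewrite mulr_ge0.
apply: ge0_ler_powR; rewrite ?nnegrE ?mulr_ge0 ?shift_ratio_ge0 ?invr_ge0 ?(ltW p_gt0)//.
(* When [gamma T n] is 0 it cannot be cancelled, but then level [n] is empty and
   the left-hand side is 0. *)
have [g0|g0] := eqVneq (gamma T n) 0%N; last first.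
  rewrite /shift_ratio -!mulrA [_^-1 * (_^-1 * _)]mulrCA mulVKf ?pnatr_eq0//.
  by rewrite [leRHS]mulrCA ler_wpM2l.
have -> : s = 0; last by rewrite mulr0 !mulr_ge0// ?shift_ratio_ge0.
rewrite /s fsbig_finite; last exact: finite_level.
by move: g0; rewrite /gamma => /cardfs0_eq ->; rewrite big_seq_fset0.
Qed.

Lemma hardy_norm_shift_le (M : R) f :
  (forall n, shift_ratio R T n <= M) ->
  (hardy_norm p (forward_shift R T f) <= (M `^ p^-1)%:E * hardy_norm p f)%E.
Proof.
move=> hM; apply: ge_ereal_sup => _ [[|n] _ <-].
  by rewrite Mp_shift0 mule_ge0 ?hardy_norm_ge0 ?lee_fin ?powR_ge0.
apply: (@le_trans _ _ ((M `^ p^-1)%:E * (Mp p n f)%:E)%E); last first.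
  by rewrite lee_pmul ?lee_fin ?powR_ge0//; apply: ereal_sup_ubound; exists n.
rewrite -EFinM lee_fin (le_trans (Mp_shift_le n f))//.
rewrite ler_wpM2r ?Mp_ge0// ge0_ler_powR ?nnegrE ?invr_ge0 ?(ltW p_gt0)//.
  exact: shift_ratio_ge0.
exact: le_trans (shift_ratio_ge0 _ _ n) (hM n).
Qed.

(** The multiple of the indicator of [w] whose [p]-mean on level [n] is 1 when
[w] belongs to that level. *)
Definition extremal n (w : T) : cfunctions R T :=
  fun v => if v == w then (((gamma T n)%:R `^ p^-1)%:C)%C else 0.

(** The weight [c] is constantly 1 for the norm of [extremal n w], and the number
of children for the norm of its shift. *)
Lemma level_sum_extremal n (w : T) (c : T -> R) : @level T n w ->
  \sum_(v \in @level T n) c v * (complex.Re `|extremal n w v : R[i]|) `^ p =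
  c w * (gamma T n)%:R.
Proof.
move=> wn; rewrite fsbig_finite; last exact: finite_level.
rewrite (bigD1_seq w) ?fset_uniq//; last first.
  by rewrite in_fset_set ?inE//; exact: finite_level.
rewrite big1 ?addr0 => [|v /negbTE vw].
  have -> : complex.Re `|extremal n w w : R[i]| = `|(gamma T n)%:R `^ p^-1|.
    by rewrite /extremal eqxx; exact: Re_norm_real.
  by rewrite ger0_norm ?powR_ge0// powR_invK//; exact: addr0.
by rewrite /extremal vw Re_norm0 powR0// mulr0.
Qed.

Lemma gamma_gt0 n (w : T) : @level T n w -> (0 < gamma T n)%N.
Proof.
move=> wn; rewrite /gamma cardfs_gt0; apply/fset0Pn; exists w.
by rewrite in_fset_set ?inE//; exact: finite_level.
Qed.

Lemma hardy_norm_extremal_le1 n (w : T) : @level T n w ->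
  (hardy_norm p (extremal n w) <= 1)%E.
Proof.
move=> wn; apply: ge_ereal_sup => _ [m _ <-]; rewrite lee_fin /Mp.
have [->|mn] := eqVneq m n.
  have := level_sum_extremal (fun=> 1) wn.
  under eq_fsbigr do rewrite mul1r.
  rewrite mul1r => ->.
  by rewrite mulVf ?powR1// pnatr_eq0 -lt0n (gamma_gt0 wn).
rewrite fsbig1 ?mulr0 ?powR0 ?invr_eq0// => v vm.
rewrite /extremal ifN ?Re_norm0 ?powR0//.
by apply: contra mn => /eqP vw; move: vm; rewrite vw -wn => <-.
Qed.

Lemma Mp_shift_extremal n (w : T) : @level T n w ->
  Mp p n.+1 (forward_shift R T (extremal n w)) =
  ((gamma1 w)%:R * (gamma T n)%:R / (gamma T n.+1)%:R) `^ p^-1.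
Proof. by move=> wn; rewrite /Mp level_sum_shift level_sum_extremal// mulrC. Qed.

(** Some element of the unit ball is shifted to a function of norm at least
[shift_ratio R T n `^ p^-1]. *)
Lemma shift_ratio_attained n : exists f,
  (hardy_norm p f <= 1)%E /\
  ((shift_ratio R T n `^ p^-1)%:E <= hardy_norm p (forward_shift R T f))%E.
Proof.
(* When [K1 T n] is 0 the ratio is 0 and the zero function suffices. *)
have [K0|/K1_attained[w wn wK]] := pselect (K1 T n = 0%N).
  exists 0; split; last first.
    by rewrite /shift_ratio K0 !mul0r powR0 ?invr_eq0// hardy_norm_ge0.
  apply: ge_ereal_sup => _ [m _ <-]; rewrite lee_fin /Mp fsbig1 => [|v _].
    by rewrite mulr0 powR0 ?invr_eq0.
  by rewrite Re_norm0 powR0.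
exists (extremal n w); split; first exact: hardy_norm_extremal_le1.
rewrite /shift_ratio -wK -Mp_shift_extremal//.
by apply: ereal_sup_ubound; exists n.+1.
Qed.

Lemma shift_ratio_le_of_bound n (r : R) : 0 <= r ->
  (forall f, (hardy_norm p f <= 1)%E ->
     (hardy_norm p (forward_shift R T f) <= r%:E)%E) ->
  shift_ratio R T n <= r `^ p.
Proof.
move=> r0 hr; have [f [f1 fn]] := shift_ratio_attained n.
have := le_trans fn (hr f f1); rewrite lee_fin => rr.
rewrite -[leLHS](powR_invK p_neq0) ?shift_ratio_ge0//.
by apply: ge0_ler_powR; rewrite ?nnegrE ?powR_ge0 ?(ltW p_gt0).
Qed.

Lemma bounded_shiftP :
  bounded_on_hardy p (forward_shift R T) <-> has_ubound (shift_ratios R T).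
Proof.
rewrite shift_ratiosE; split=> [[_ [C hC]]|[M hM]].
  (* Taking the maximum with 0 makes the constant nonnegative. *)
  exists (Num.max 0 C `^ p) => _ [n _ <-].
  apply: shift_ratio_le_of_bound => [|f f1]; first by rewrite le_max lexx.
  apply: le_trans (hC f _) _; first exact: le_lt_trans f1 (ltry _).
  apply: (@le_trans _ _ ((Num.max 0 C)%:E * hardy_norm p f)%E).
    by rewrite lee_wpmul2r ?hardy_norm_ge0// lee_fin le_max lexx orbT.
  by rewrite -[leRHS]mule1 lee_wpmul2l// lee_fin le_max lexx.
have nM n : shift_ratio R T n <= M by apply: hM; exists n.
split=> [f fH|]; last first.
  by exists (M `^ p^-1) => f _; exact: hardy_norm_shift_le.
apply: le_lt_trans (hardy_norm_shift_le f nM) _.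
by rewrite lte_mul_pinfty ?lee_fin ?powR_ge0.
Qed.

Lemma hardy_opnorm_shift : has_ubound (shift_ratios R T) ->
  hardy_opnorm p (forward_shift R T) =
  ((sup (shift_ratios R T)) `^ p^-1)%:E.
Proof.
rewrite shift_ratiosE => ub; set N := hardy_opnorm _ _; set M := sup _.
have nM n : shift_ratio R T n <= M by apply: ub_le_sup => //; exists n.
have N_le : (N <= (M `^ p^-1)%:E)%E.
  apply: ge_ereal_sup => _ [f [_ f1] <-].
  apply: le_trans (hardy_norm_shift_le f nM) _.
  by rewrite -[leRHS]mule1 lee_wpmul2l// lee_fin powR_ge0.
have leN f : (hardy_norm p f <= 1)%E ->
    (hardy_norm p (forward_shift R T f) <= N)%E.
  move=> f1; apply: ereal_sup_ubound; exists f => //; split=> //.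
  exact: le_lt_trans f1 (ltry _).
have [f0 [f01 _]] := shift_ratio_attained 0.
have N0 : (0 <= N)%E by apply: le_trans (hardy_norm_ge0 _) (leN _ f01).
apply/eqP; rewrite eq_le N_le/=.
case: N N0 N_le leN => [r| |]//; rewrite !lee_fin => r0 _ leN.
rewrite -[leRHS](powRK_inv p_neq0)//.
have Mr : M <= r `^ p.
  apply: ge_sup => [|_ [n _ <-]]; first by exists (shift_ratio R T 0), 0%N.
  exact: shift_ratio_le_of_bound.
apply: ge0_ler_powR; rewrite ?nnegrE ?powR_ge0 ?invr_ge0 ?(ltW p_gt0)//.
exact: le_trans (shift_ratio_ge0 _ _ 0) (nM 0%N).
Qed.

End shift_means.

Theorem theorem3p1p1 (R : realType) (T : tree) (p : R) (hp : 1 <= p) :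
  (bounded_on_hardy p (forward_shift R T) <-> bounded_set (shift_ratios R T)) /\
  (bounded_on_hardy p (forward_shift R T) ->
   hardy_opnorm p (forward_shift R T) =
   ((sup (shift_ratios R T)) `^ p^-1)%:E).
Proof.
have p_gt0 : 0 < p by exact: lt_le_trans hp.
split; first by rewrite bounded_shift_ratios; exact: bounded_shiftP.
by move=> /(bounded_shiftP _ p_gt0); exact: hardy_opnorm_shift.
Qed.
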